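(* Let $T$ be a complete theory with monster model $\mathbb M$, let $\mathrm{cl}$ be an existential matroid on $\mathbb M$, and assume that the dimension induced by $\mathrm{cl}$ is definable. Then the theory $T^d$ (of pairs $\langle\mathbb K,\mathbb F\rangle$ with $\mathbb K\models T$ and $\mathbb F$ a proper, $\mathrm{cl}$-closed, dense subset of $\mathbb K$) is consistent.
   Context: Conventions: $T$ is a complete first-order theory in a language $\mathcal L$ with only infinite models; $\kappa>|T|$ is a large cardinal; $\mathbb M$ is a $\kappa$-saturated, strongly $\kappa$-homogeneous model of $T$. ''Small'' means of cardinality $<\kappa$; ''definable'' means definable with parameters. A (finitary) matroid on $\mathbb M$ is an operator $\mathrm{cl}:\mathcal P(\mathbb M)\to\mathcal P(\mathbb M)$ with: $X\subseteq \mathrm{cl}(X)$; $X\subseteq Y\Rightarrow \mathrm{cl}(X)\subseteq \mathrm{cl}(Y)$; $\mathrm{cl}(\mathrm{cl}(X))=\mathrm{cl}(X)$; $\mathrm{cl}(X)=\bigcup\{\mathrm{cl}(A): A\subseteq X \text{ finite}\}$; and exchange: $a\in \mathrm{cl}(X\cup\{c\})\setminus \mathrm{cl}(X)$ implies $c\in\mathrm{cl}(X\cup\{a\})$. An $\mathcal L$-formula $\phi(x,\bar y)$ without parameters, $x$ a single variable, is $x$-narrow if for all $a,\bar b$, $\mathbb M\models\phi(a,\bar b)$ implies $a\in\mathrm{cl}(\bar b)$. The matroid is definable if for every $A$, $\mathrm{cl}(A)$ is the union of the sets $\phi(\mathbb M,\bar a)$ with $\phi$ $x$-narrow and $\bar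 a$ a finite tuple from $A$. It satisfies Existence if for every element $a$ and all small $B,C$ with $a\notin\mathrm{cl}(B)$ there is $a'$ with the same type as $a$ over $B$ and $a'\notin\mathrm{cl}(B\cup C)$. The trivial matroid is $\mathrm{cl}^0(X)=\mathbb M$ for all $X$. An existential matroid is a definable matroid that satisfies Existence and is not trivial. Via the $x$-narrow formulas, $\mathrm{cl}$ transfers to any other monster model of $T$. $\mathrm{rk}(\bar b/A)$ is the cardinality of a maximal subtuple of $\bar b$ that is $\mathrm{cl}$-independent over $A$. For $V\subseteq\mathbb M^n$ definable over a small $A$, $\dim(V)=\max\{\mathrm{rk}(\bar b/A):\bar b\in V\}$, $\dim(\emptyset)=-\infty$. The dimension is definable if for every definable $X\subseteq\mathbb M^m\times\mathbb M^n$ and every $e$, $\{\bar a\in\mathbb M^m:\dim(X_{\bar a})=e\}$ is definable. Let $\mathbb K\models T$, viewed as an elementary substructure of a monster model; the dimension of a $\mathbb K$-definable set is that of its interpretation in the monster model. $X\subseteq\mathbb K$ is dense in $\mathbb K$ if $U\cap X\neq\emptyset$ for every $\mathbb K$-definable $U\subseteq\mathbb K$ with $\dim(U)=1$; $X$ is $\mathrm{cl}$-closed in $\mathbb K$ if $\mathrm{cl}(X)\cap\mathbb K=X$. $\mathcal L^2$ is $\mathcal L$ with a new unary predicate $P$. $T^d$ is the $\mathcal L^2$-theory whose models are the pairs $\langle\mathbb K,\mathbb F\rangle$ with $\mathbb K\models T$ and $\mathbb F=P(\mathbb K)$ a proper subset of $\mathbb K$ that is $\mathrm{cl}$-closed and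 dense in $\mathbb K$ (it then follows that $\mathbb F\prec\mathbb K$). *)

(* Defs.v *)
From mathcomp Require Import all_boot.
From mathcomp Require Import boolp classical_sets functions cardinality.

Set Implicit Arguments.
Unset Strict Implicit.
Unset Printing Implicit Defensive.

Local Open Scope classical_set_scope.
Local Open Scope card_scope.

(* Finite tuples are functions out of ordinals: X^n is ['I_n -> X]. *)
Definition tcat (X : Type) (m n : nat) (u : 'I_m -> X) (v : 'I_n -> X) :
    'I_(m + n) -> X :=
  fun i => match fintype.split i with inl j => u j | inr j => v j end.

Definition tone (X : Type) (a : X) : 'I_1 -> X := fun=> a.

Record language : Type := Language {
  fsym : Type;
  farity : fsym -> nat;
  rsym : Type;
  rarity : rsym -> nat
}.

Record structure (L : language) : Type := Structure {
  carrier :> Type;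
  carrier_nonempty : inhabited carrier;
  finterp : forall f : fsym L, ('I_(farity f) -> carrier) -> carrier;
  rinterp : forall r : rsym L, ('I_(rarity r) -> carrier) -> Prop
}.

Inductive term (L : language) (n : nat) : Type :=
| Var of 'I_n
| App (f : fsym L) of ('I_(farity f) -> term L n).

(* [formula L n]: formulas whose free variables are among the n variables
   indexed by ['I_n]; the variable bound by [All] is the one of index 0. *)
Inductive formula (L : language) : nat -> Type :=
| Bot n : formula L n
| Eq n : term L n -> term L n -> formula L n
| Rel n (r : rsym L) : ('I_(rarity r) -> term L n) -> formula L n
| Imp n : formula L n -> formula L n -> formula L n
| All n : formula L (1 + n) -> formula L n.

Arguments Bot {L n}.

Notation sentence L := (formula L 0).

Fixpoint eval (L : language) (M : structure L) (n : nat) (v : 'I_n -> M)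
    (t : term L n) : M :=
  match t with
  | Var i => v i
  | App f ts => finterp (fun i => eval v (ts i))
  end.

Fixpoint sat (L : language) (M : structure L) (n : nat) (phi : formula L n) :
    ('I_n -> M) -> Prop :=
  match phi with
  | Bot _ => fun _ => False
  | Eq _ s t => fun v => eval v s = eval v t
  | Rel _ r ts => fun v => rinterp (fun i => eval v (ts i))
  | Imp _ phi psi => fun v => sat phi v -> sat psi v
  | All _ phi => fun v => forall a : M, sat phi (tcat (tone a) v)
  end.

Definition theory (L : language) := set (sentence L).

Definition satisfies (L : language) (M : structure L) (s : sentence L) : Prop :=
  forall v : 'I_0 -> M, sat s v.

Definition models (L : language) (M : structure L) (T : theory L) : Prop :=
  forall s, T s -> satisfies M s.

Definition consistent (L : language) (T : theory L) : Prop :=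
  exists M : structure L, models M T.

Definition entails (L : language) (T : theory L) (s : sentence L) : Prop :=
  forall M : structure L, models M T -> satisfies M s.

Definition complete (L : language) (T : theory L) : Prop :=
  consistent T /\ forall s, entails T s \/ entails T (Imp s Bot).

Definition only_infinite_models (L : language) (T : theory L) : Prop :=
  forall M : structure L, models M T -> infinite_set [set: M].

(* [pformula M n]: formulas in n variables with parameters from M. *)
Record pformula (L : language) (M : structure L) (n : nat) : Type := PFormula {
  pf_npar : nat;
  pf_form : formula L (n + pf_npar);
  pf_par : 'I_pf_npar -> M
}.

Arguments pf_npar {L M n} _.
Arguments pf_form {L M n} _.
Arguments pf_par {L M n} _ _.

Definition pf_over (L : language) (M : structure L) (n : nat) (A : set M)
    (c : pformula M n) : Prop :=
  range (pf_par c) `<=` A.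

Definition pf_set (L : language) (M : structure L) (n : nat)
    (c : pformula M n) : set ('I_n -> M) :=
  [set v | sat (pf_form c) (tcat v (pf_par c))].

Definition definable_over (L : language) (M : structure L) (n : nat)
    (A : set M) (V : set ('I_n -> M)) : Prop :=
  exists c : pformula M n, pf_over A c /\ V = pf_set c.

Definition definable (L : language) (M : structure L) (n : nat)
    (V : set ('I_n -> M)) : Prop :=
  definable_over [set: M] V.

Definition same_type (L : language) (M : structure L) (B : set M) (a a' : M) :
    Prop :=
  forall c : pformula M 1, pf_over B c ->
    (pf_set c (tone a) <-> pf_set c (tone a')).

Definition elementary_embedding (L : language) (K M : structure L)
    (e : K -> M) : Prop :=
  forall n (phi : formula L n) (v : 'I_n -> K), sat phi v <-> sat phi (e \o v).

Definition partial_elementary (L : language) (M : structure L) (A : set M)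
    (f : M -> M) : Prop :=
  forall n (phi : formula L n) (v : 'I_n -> M), range v `<=` A ->
    (sat phi v <-> sat phi (f \o v)).

Definition automorphism (L : language) (M : structure L) (s : M -> M) : Prop :=
  [/\ bijective s,
      forall (f : fsym L) (v : 'I_(farity f) -> M),
        s (finterp v) = finterp (s \o v)
    & forall (r : rsym L) (v : 'I_(rarity r) -> M),
        rinterp v <-> rinterp (s \o v)].

(* A cardinal kappa is given by a type of that cardinality. *)
Definition cardinal : Type := Type.

Definition small (kap : cardinal) (X : Type) (A : set X) : Prop :=
  (A #<= [set: kap]) /\ ~ ([set: kap] #<= A).

Definition saturated (L : language) (kap : cardinal) (M : structure L) : Prop :=
  forall (A : set M) (p : set (pformula M 1)),
    small kap A ->
    (forall c, p c -> pf_over A c) ->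
    (forall q, finite_set q -> q `<=` p -> exists a : M,
       forall c, q c -> pf_set c (tone a)) ->
    exists a : M, forall c, p c -> pf_set c (tone a).

Definition strongly_homogeneous (L : language) (kap : cardinal)
    (M : structure L) : Prop :=
  forall (A : set M) (f : M -> M),
    small kap A -> partial_elementary A f ->
    exists s : M -> M, automorphism s /\ forall a, A a -> s a = f a.

(* As T is complete, |T| is the number of all L-formulas, i.e. |L| + aleph_0. *)
Record monster (L : language) (T : theory L) (kap : cardinal) (M : structure L) :
    Prop := Monster {
  monster_models : models M T;
  monster_card : small kap [set: {n : nat & formula L n}];
  monster_saturated : saturated kap M;
  monster_homogeneous : strongly_homogeneous kap M
}.

Record matroid (X : Type) (cl : set X -> set X) : Prop := Matroid {
  cl_ext : forall A, A `<=` cl A;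
  cl_mono : forall A B, A `<=` B -> cl A `<=` cl B;
  cl_idem : forall A, cl (cl A) = cl A;
  cl_finitary : forall A,
    cl A = \bigcup_(B in [set B | finite_set B /\ B `<=` A]) cl B;
  cl_exchange : forall A a c,
    (cl (A `|` [set c]) `\` cl A) a -> cl (A `|` [set a]) c
}.

(* [phi (x, y)] with x the variable of index 0. *)
Definition narrow (L : language) (M : structure L) (cl : set M -> set M)
    (k : nat) (phi : formula L (1 + k)) : Prop :=
  forall (a : M) (b : 'I_k -> M), sat phi (tcat (tone a) b) -> cl (range b) a.

(* The operator that the narrow formulas of (M, cl) define on any structure N;
   on another monster model it is the transfer of cl. *)
Definition transfer (L : language) (M : structure L) (cl : set M -> set M)
    (N : structure L) (A : set N) : set N :=
  [set x | exists (k : nat) (phi : formula L (1 + k)) (a : 'I_k -> N),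
     [/\ narrow cl phi, range a `<=` A & sat phi (tcat (tone x) a)]].

Definition cl_definable (L : language) (M : structure L)
    (cl : set M -> set M) : Prop :=
  forall A : set M, cl A = transfer cl A.

Definition cl_existence (L : language) (kap : cardinal) (M : structure L)
    (cl : set M -> set M) : Prop :=
  forall (a : M) (B C : set M), small kap B -> small kap C -> ~ cl B a ->
    exists a' : M, same_type B a a' /\ ~ cl (B `|` C) a'.

Record existential_matroid (L : language) (kap : cardinal) (M : structure L)
    (cl : set M -> set M) : Prop := ExistentialMatroid {
  em_matroid : matroid cl;
  em_definable : cl_definable cl;
  em_existence : cl_existence kap cl;
  em_nontrivial : ~ (forall A, cl A = [set: M])
}.

(* The subtuple of b with index set S is cl-independent over A. *)
Definition independent (X : Type) (cl : set X -> set X) (A : set X) (n : nat)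
    (b : 'I_n -> X) (S : {set 'I_n}) : Prop :=
  forall i, i \in S -> ~ cl (A `|` b @` [set j | j \in S /\ j <> i]) (b i).

(* By exchange all maximal independent subtuples have the same length, so the
   outer maximum just picks out that common value. *)
Definition rk (X : Type) (cl : set X -> set X) (A : set X) (n : nat)
    (b : 'I_n -> X) : nat :=
  \max_(S : {set 'I_n} | maxset (fun S => `[< independent cl A b S >]) S) #|S|.

(* [has_dim kap cl V e] is "dim V = e", with [None] standing for -oo. It does
   not depend on the small set A over which V is defined. *)
Definition has_dim (L : language) (kap : cardinal) (M : structure L)
    (cl : set M -> set M) (n : nat) (V : set ('I_n -> M)) (e : option nat) :
    Prop :=
  exists A : set M, [/\ small kap A, definable_over A V
    & match e with
      | None => V = set0
      | Some d => (exists2 b, V b & rk cl A b = d) /\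
                  (forall b, V b -> rk cl A b <= d)
      end].

(* M^m x M^n is identified with M^(m + n). *)
Definition dim_definable (L : language) (kap : cardinal) (M : structure L)
    (cl : set M -> set M) : Prop :=
  forall (m n : nat) (X : set ('I_(m + n) -> M)), definable X ->
    forall e : option nat,
      definable [set a : 'I_m -> M |
                  has_dim kap cl [set b : 'I_n -> M | X (tcat a b)] e].

(* In [cl_closed_in] and [dense_in], e is meant to be an elementary embedding of
   K into a monster model M with closure operator cl. *)
Definition cl_closed_in (L : language) (K M : structure L) (e : K -> M)
    (cl : set M -> set M) (F : set K) : Prop :=
  e @^-1` (cl (e @` F)) = F.

Definition pf_map (L : language) (K M : structure L) (e : K -> M) (n : nat)
    (c : pformula K n) : pformula M n :=
  PFormula (pf_form c) (e \o pf_par c).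

Definition dense_in (L : language) (kap : cardinal) (K M : structure L)
    (e : K -> M) (cl : set M -> set M) (F : set K) : Prop :=
  forall c : pformula K 1, has_dim kap cl (pf_set (pf_map e c)) (Some 1) ->
    exists a : K, F a /\ pf_set c (tone a).

(* L expanded by a unary predicate P, which is the relation symbol [None]. *)
Definition language2 (L : language) : language :=
  {| fsym := fsym L;
     farity := @farity L;
     rsym := option (rsym L);
     rarity := fun r => if r is Some r' then rarity r' else 1 |}.

Definition reduct (L : language) (N : structure (language2 L)) : structure L :=
  {| carrier := N;
     carrier_nonempty := carrier_nonempty N;
     finterp := fun f : fsym L => @finterp _ N f;
     rinterp := fun r : rsym L => @rinterp _ N (Some r) |}.

Definition Ppart (L : language) (N : structure (language2 L)) :
    set (reduct N) :=
  [set a | @rinterp _ N None (tone a)].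

Arguments Ppart {L} N _.

Definition dense_pair (L : language) (T : theory L) (M : structure L)
    (cl : set M -> set M) (N : structure (language2 L)) : Prop :=
  models (reduct N) T /\ Ppart N <> [set: reduct N] /\
  exists (kap' : cardinal) (M' : structure L) (e : reduct N -> M'),
    [/\ monster T kap' M',
        elementary_embedding e,
        cl_closed_in e (transfer cl (N := M')) (Ppart N)
      & dense_in kap' e (transfer cl (N := M')) (Ppart N)].

(* The theory of the class of dense pairs. Being consistent, for this theory
   as for any axiomatisation of the class, means that the class is nonempty. *)
Definition Td (L : language) (T : theory L) (M : structure L)
    (cl : set M -> set M) : theory (language2 L) :=
  [set s | forall N : structure (language2 L), dense_pair T cl N ->
             satisfies N s].

(* Main.v *)
Require Import Defs.
From mathcomp Require Import all_boot.
From mathcomp Require Import boolp classical_sets functions cardinality.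

Set Implicit Arguments.
Unset Strict Implicit.
Unset Printing Implicit Defensive.

Local Open Scope classical_set_scope.
Local Open Scope card_scope.

(** Fix b outside cl(0), and build inside M an increasing chain of sets
    F_n `<=` K_n of cardinality at most |L| + aleph_0 with b in K_n and b outside
    cl(F_n).  K_{n+1} gets a solution of every formula over K_n that has one, and
    F_{n+1} a point of every one-dimensional set defined over K_n.  By Existence
    that point can be taken outside the closure of b and of what is already in
    F_{n+1}, so by exchange b stays outside the closure of F_{n+1}.  The union K
    is an elementary substructure by the Tarski-Vaught test, and (K, cl(F) & K)
    is a dense pair, properness being witnessed by b. *)

(** * Injections between sets, and finite subsets of unions of chains *)

Definition injects (X Y : Type) (A : set X) (B : set Y) : Prop :=
  exists f : X -> Y, (forall x, A x -> B (f x)) /\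
    (forall x y, A x -> A y -> f x = f y -> x = y).

Lemma injects_card_le (X Y : Type) (A : set X) (B : set Y) :
  injects A B -> A #<= B.
Proof.
move=> [f [fAB finj]]; apply/card_subP; exists (f @` A).
  by apply: inj_card_eq => x y /set_mem Ax /set_mem Ay; exact: finj.
by move=> _ [x Ax <-]; exact: fAB.
Qed.

Lemma injects_trans (X Y Z : Type) (A : set X) (B : set Y) (C : set Z) :
  injects A B -> injects B C -> injects A C.
Proof.
move=> [f [fAB finj]] [g [gBC ginj]]; exists (g \o f); split=> [x /fAB/gBC//|].
by move=> x y Ax Ay /= /(ginj _ _ (fAB _ Ax) (fAB _ Ay)); exact: finj.
Qed.

Lemma subset_injects (X : Type) (A B : set X) : A `<=` B -> injects A B.
Proof. by move=> AB; exists id; split. Qed.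

Lemma finite_sub_chain (X J : Type) (P : set J) (A : J -> set X) (B : set X) :
    P !=set0 ->
    (forall i j, P i -> P j -> A i `<=` A j \/ A j `<=` A i) ->
    finite_set B -> B `<=` \bigcup_(i in P) A i ->
  exists2 i, P i & B `<=` A i.
Proof.
(* Gives [X] a choice structure, so that [B] can be listed as a sequence. *)
elim/Pchoice: X => X in A B *.
move=> [i0 Pi0] tot /finite_seqP[s ->]; elim: s => [|x s IHs] sA.
  by exists i0 => // x /=; rewrite in_nil.
have [|i Pi si] := IHs.
  by move=> y /= ys; apply: sA => /=; rewrite in_cons ys orbT.
have [|j Pj xj] := sA x; first by rewrite /= mem_head.
have [ij|ji] := tot i j Pi Pj.
  by exists j => // y /=; rewrite in_cons => /orP[/eqP->//|/si/ij].
by exists i => // y /=; rewrite in_cons => /orP[/eqP->|/si//]; exact: ji.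
Qed.

(** * Coding formulas with parameters by sentences *)

Section Code.
Variable L : language.

(** A total projection; such projections give injectivity of the constructors without inverting
    equalities between indexed terms. *)
Definition imp_left n (phi : formula L n) : formula L n :=
  match phi with Imp _ a _ => a | a => a end.

Definition imp_right n (phi : formula L n) : formula L n :=
  match phi with Imp _ _ b => b | b => b end.

Definition all_body n (phi : formula L n) : formula L (1 + n) :=
  match phi with All _ a => a | _ => Bot end.

Lemma Imp_inj n (a b c d : formula L n) : Imp a b = Imp c d -> a = c /\ b = d.
Proof.
move=> e; split; first exact: (congr1 (@imp_left n) e).
exact: (congr1 (@imp_right n) e).
Qed.

Lemma All_inj n : injective (@All L n).
Proof. move=> a b e; exact: (congr1 (@all_body n) e). Qed.

Fixpoint close n : formula L n -> sentence L :=
  match n with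
  | 0 => id
  | n'.+1 => fun phi => @close n' (@All L n' phi)
  end.

Lemma close_inj n : injective (@close n).
Proof. by elim: n => [|n IHn] phi psi //= /IHn/All_inj. Qed.

(* Finite sequences of sentences are coded by sentences; this replaces the
   cardinal arithmetic of |L| + aleph_0. *)
Fixpoint code_seq (s : seq (sentence L)) : sentence L :=
  if s is a :: s' then Imp a (code_seq s') else Bot.

Lemma code_seq_inj : injective code_seq.
Proof. by elim=> [|a s IHs] [|b t] //= /Imp_inj[-> /IHs->]. Qed.

Definition code_nat (k : nat) : sentence L := code_seq (nseq k Bot).

Lemma code_nat_inj : injective code_nat.
Proof. by move=> k l /code_seq_inj/(congr1 size); rewrite !size_nseq. Qed.

(** The prefix records [n], which [close] forgets: [close] is injective only for each fixed [n]. *)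
Definition code_form (n : nat) (phi : formula L n) : sentence L :=
  Imp (code_nat n) (close phi).

(** Expresses that [A] has cardinality at most |L| + aleph_0. *)
Definition codable (X : Type) (A : set X) : Prop :=
  injects A [set: sentence L].

Lemma codable_small (kap : cardinal) (X : Type) (A : set X) :
  small kap [set: {n : nat & formula L n}] -> codable A -> small kap A.
Proof.
move=> [le_kap nle_kap] codA.
have leA : A #<= [set: {n : nat & formula L n}].
  apply: injects_card_le; apply: injects_trans codA _.
  exists (fun s : sentence L => existT (fun n : nat => formula L n) 0 s).
  split=> // s t _ _.
  exact: eq_from_Tagged.
split; first exact: card_le_trans leA le_kap.
by move=> kapA; apply/nle_kap/card_le_trans/leA.
Qed.

Lemma codableU (X : Type) (A B : set X) :
  codable A -> codable B -> codable (A `|` B).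
Proof.
move=> [f [_ finj]] [g [_ ginj]].
(* The premises [Bot] and [code_nat 1], which is [Imp Bot Bot], differ and so tell the two cases
   apart. *)
exists (fun x => if `[< A x >] then Imp Bot (f x) else Imp (code_nat 1) (g x)).
split=> // x y AB_x AB_y.
case: asboolP => [Ax|nAx]; case: asboolP => [Ay|nAy] /Imp_inj[] //= _.
  exact: finj.
by case: AB_x => // Bx; case: AB_y => // By; exact: ginj.
Qed.

Lemma codable1 (X : Type) (a : X) : codable [set a].
Proof. by exists (fun=> Bot); split=> // x y -> ->. Qed.

Lemma codable_image (X Y : Type) (A : set X) (f : X -> Y) :
  codable A -> codable (f @` A).
Proof.
move=> codA; case: (pselect (A !=set0)) => [[x0 _]|A0]; last first.
  by exists (fun=> Bot); split=> // y z [x Ax _]; case: A0; exists x.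
have /choice[g gP] : forall y, exists x, (f @` A) y -> A x /\ f x = y.
  move=> y; case: (pselect ((f @` A) y)) => [[x Ax fx]|nA]; last by exists x0.
  by exists x.
apply: injects_trans codA; exists g; split=> [y /gP[]//|y z /gP[_ fy] /gP[_ fz] e].
by rewrite -[LHS]fy e.
Qed.

(** The code joins the code of the formula to the list of codes of its parameters. *)
Lemma codable_pformula (M : structure L) (n : nat) (A : set M) :
  codable A -> codable [set c : pformula M n | pf_over A c].
Proof.
move=> [f [_ finj]].
exists (fun c => Imp (code_form (pf_form c))
  (code_seq [seq f (pf_par c i) | i <- enum 'I_(pf_npar c)])).
split=> // -[k phi u] [l psi v] /= Au Av /Imp_inj[] /Imp_inj[].
(* The numbers of parameters must be identified first; only then do both formulas have the same
   type. *)
move=> /code_nat_inj/addnI kl; subst l; move=> /close_inj -> /code_seq_inj/eq_in_map uv; congr PFormula.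
apply/funext => i; apply: finj; [by apply: Au; exists i|by apply: Av; exists i|].
by apply: uv; rewrite mem_enum.
Qed.

End Code.

(** * Matroids: exchange, chains and generic choices *)

Section Matroid.
Variables (X : Type) (cl : set X -> set X).
Hypothesis clM : matroid cl.

(** If the point were in [cl A], only the empty subtuple would be independent and the rank would be
    0. *)
Lemma rk1_notin (A : set X) (b : 'I_1 -> X) : rk cl A b = 1 -> ~ cl A (b ord0).
Proof.
move=> rk1 clAb.
suff: rk cl A b = 0 by rewrite rk1.
apply: big1 => S /maxsetP[/asboolP indS _].
apply/eqP; rewrite cards_eq0; apply/eqP/setP => i; rewrite inE.
apply/negP => iS; apply: (indS i iS); rewrite [i]ord1.
by apply: cl_mono clAb => // x Ax; left.
Qed.

Lemma notin_cl_swap (A : set X) (a b : X) :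
  ~ cl A b -> ~ cl (A `|` [set b]) a -> ~ cl (A `|` [set a]) b.
Proof. by move=> nAb nAba Aab; apply: nAba; apply: (cl_exchange clM). Qed.

(** By finitariness a finite subset of the union already has [b] in its closure, and it lies in one
    member of the chain. *)
Lemma cl_chain (J : Type) (P : set J) (A : J -> set X) (b : X) :
    P !=set0 ->
    (forall i j, P i -> P j -> A i `<=` A j \/ A j `<=` A i) ->
    cl (\bigcup_(i in P) A i) b ->
  exists2 i, P i & cl (A i) b.
Proof.
move=> P0 tot; rewrite (cl_finitary clM) => -[B [finB BA] clBb].
have [i Pi BAi] := finite_sub_chain P0 tot finB BA.
by exists i => //; exact: cl_mono clBb.
Qed.

(* A maximal partial choice function, given as a graph S, is total on D: the
   elements chosen so far inject into E, so a further one can be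
   taken outside cl (F U {b} U S), and exchange keeps b out. *)
Lemma generic_choice (I J : Type) (D : set I) (E : set J) (V : I -> set X)
    (F : set X) (b : X) :
    E !=set0 -> injects D E -> ~ cl F b ->
    (forall i S, D i -> injects S E ->
       exists2 a, V i a & ~ cl (F `|` S `|` [set b]) a) ->
  exists S : set X, [/\ injects S E, ~ cl (F `|` S) b
    & forall i, D i -> exists2 a, S a & V i a].
Proof.
move=> [j0 Ej0] DE nFb ext.
pose G (S : set (I * X)) := [/\ forall p, S p -> D p.1 /\ V p.1 p.2,
  forall p q, S p -> S q -> p.1 = q.1 -> p = q & ~ cl (F `|` snd @` S) b].
have injG S : G S -> injects (snd @` S) E.
  move=> [SV Sfun _].
  case: (pselect (D !=set0)) => [[i0 _]|D0]; last first.
    exists (fun=> j0); split=> // a c [p Sp _]; case: D0.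
    by exists p.1; case: (SV _ Sp).
  apply: injects_trans DE.
  (* Each chosen value is sent to an index it was chosen for; this is injective because [S] is
     single-valued. *)
  have /choice[g gP] : forall a, exists i, (snd @` S) a -> S (i, a).
    move=> a; case: (pselect ((snd @` S) a)) => [[[i c] Sp /= <-]|nS].
      by exists i.
    by exists i0.
  exists g; split=> [a /gP/SV[]//|a c /gP Sa /gP Sc gac].
  by case: (Sfun _ _ Sa Sc gac).
have [C CG totC|S [GS maxS]] := @Zorn_bigcup _ G.
  split.
  - by move=> p [S /CG[SV _ _]]; exact: SV.
  - move=> p q [S CS Sp] [S' CS' Sq].
    have [_ Sfun _] := CG _ CS; have [_ Sfun' _] := CG _ CS'.
    by have [/(_ _ Sp) Sp'|/(_ _ Sq) Sq'] := totC _ _ CS CS';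
      [exact: Sfun'|exact: Sfun].
  (* Finitariness handles a nonempty chain; the empty chain has empty union, where [nFb]
     suffices. *)
  - case: (pselect (C !=set0)) => [C0|C0].
      have -> : F `|` snd @` (\bigcup_(S in C) S) =
                \bigcup_(S in C) (F `|` snd @` S).
        rewrite image_bigcup; apply/seteqP; split=> [a [Fa|[S CS Sa]]|a [S CS []]].
        + by have [S CS] := C0; exists S => //; left.
        + by exists S => //; right.
        + by left.
        + by right; exists S.
      move=> /(cl_chain C0)[|S CS].
        move=> S S' CS CS'; have [SS'|S'S] := totC _ _ CS CS'; [left|right];
          by apply: setUS; exact: image_subset.
      by have [] := CG _ CS.
    have -> : \bigcup_(S in C) S = set0.
      by rewrite -subset0 => p [S CS _]; apply: C0; exists S.
    by rewrite image_set0 setU0.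
exists (snd @` S); split; [exact: injG|by case: GS|].
move=> i Di; have [SV Sfun nSb] := GS.
case: (pselect (exists a, S (i, a))) => [[a Sa]|nSi].
  by exists a; [exists (i, a)|case: (SV _ Sa)].
(* If [i] has no value yet, a generic one can be added to [S], against maximality. *)
have [a Va na] := ext i (snd @` S) Di (injG _ GS).
have /(maxS (S `|` [set (i, a)])) : S `<` S `|` [set (i, a)].
  split; first exact: subsetUl.
  by move=> /(_ (i, a)) SSa; apply: nSi; exists a; apply: SSa; right.
case; split.
- by move=> p [/SV//|->].
- move=> p q [Sp|->] [Sq|->] //= pq; first exact: Sfun.
    by case: nSi; exists p.2; rewrite -pq -surjective_pairing.
  by case: nSi; exists q.2; rewrite pq -surjective_pairing.
- rewrite image_setU image_set1 setUA; exact: notin_cl_swap.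
Qed.

End Matroid.

(** * Elementary substructures expanded by a predicate *)

Lemma comp_tcat (X Y : Type) (m n : nat) (e : X -> Y) (u : 'I_m -> X)
    (v : 'I_n -> X) :
  e \o tcat u v = tcat (e \o u) (e \o v).
Proof. by apply/funext => i; rewrite /tcat /=; case: fintype.split. Qed.

Section Pair.
Variables (L : language) (M : structure L) (K G : set M).
Hypothesis K0 : K !=set0.
Hypothesis K_closed : forall c : pformula M 1, pf_over K c ->
  (exists a, pf_set c (tone a)) -> exists2 a, K a & pf_set c (tone a).

(** The value of the function is the only solution of the formula x = f(v) over [K]. *)
Lemma finterp_closed (f : Defs.fsym L) (v : 'I_(farity f) -> M) :
  (forall i, K (v i)) -> K (finterp v).
Proof.
move=> Kv.
pose phi : formula L (1 + farity f) :=
  Eq (Var L (lshift _ ord0)) (App (fun i => Var L (rshift 1 i))).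
have satE a : sat phi (tcat (tone a) v) <-> a = finterp v.
  rewrite /= {1}/tcat (unsplitK (inl _)).
  suff -> : (fun i => tcat (tone a) v (rshift 1 i)) = v by [].
  by apply/funext => i; rewrite /tcat (unsplitK (inr _)).
have [||a Ka /satE <-//] := @K_closed (@PFormula L M 1 (farity f) phi v).
- by move=> _ [i _ <-]; exact: Kv.
- by exists (finterp v); apply/satE.
Qed.

Definition pair_finterp (f : Defs.fsym L) (v : 'I_(farity f) -> {x | K x}) :
    {x | K x} :=
  exist _ (finterp (fun i => sval (v i))) (finterp_closed (fun i => svalP (v i))).

Definition pair_rinterp (r : option (rsym L)) :
    ('I_(@rarity (language2 L) r) -> {x | K x}) -> Prop :=
  match r return ('I_(@rarity (language2 L) r) -> {x | K x}) -> Prop with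
  | Some r' => fun v => @rinterp L M r' (fun i => sval (v i))
  | None => fun v => G (sval (v ord0))
  end.

Lemma pair_inhabited : inhabited {x | K x}.
Proof. by case: K0 => x Kx; exact: inhabits (exist _ x Kx). Qed.

Definition pair_structure : structure (language2 L) :=
  @Structure (language2 L) {x | K x} pair_inhabited pair_finterp pair_rinterp.

Definition pair_embed (x : reduct pair_structure) : M := sval x.

Lemma eval_pair n (t : term L n) (v : 'I_n -> reduct pair_structure) :
  pair_embed (eval v t) = eval (pair_embed \o v) t.
Proof.
elim: t => [i|f ts IH] //=.
by rewrite /pair_embed /=; congr finterp; apply/funext => i; exact: IH.
Qed.

(** The Tarski-Vaught test, by induction on formulas; only the quantifier case needs [K_closed]
    directly. *)
Lemma pair_embed_elementary : elementary_embedding pair_embed.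
Proof.
move=> n phi.
elim: phi => {n} [n|n s t|n r ts|n phi IHphi psi IHpsi|n phi IH] v //=.
- rewrite -!eval_pair; split=> [->//|]; case: (eval v s) (eval v t) => [x Kx] [y Ky].
  by rewrite /pair_embed /= => xy; exact: eq_exist.
- suff -> : (fun i => eval (pair_embed \o v) (ts i)) =
            (fun i => pair_embed (eval v (ts i))) by [].
  by apply/funext => i; rewrite eval_pair.
- by rewrite IHphi IHpsi.
- split=> H a; last by apply/IH; rewrite comp_tcat; exact: H.
  (* A counterexample [a] in [M] solves the negation of [phi], a formula over [K], so there is a
     counterexample in [K]. *)
  apply: contrapT => nphi.
  have [||b Kb nb] :=
    @K_closed (@PFormula L M 1 n (Imp phi Bot) (pair_embed \o v)).
  + by move=> _ [i _ <-]; exact: svalP.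
  + by exists a.
  apply: nb; have /IH := H (exist _ b Kb).
  by rewrite comp_tcat.
Qed.

End Pair.

(** * Generic points and the chain of stages *)

Lemma has_dim1_generic (L : language) (kap : cardinal) (M : structure L)
    (cl : set M -> set M) (V : set ('I_1 -> M)) (C : set M) :
    existential_matroid kap cl -> has_dim kap cl V (Some 1) -> small kap C ->
  exists2 a, V (tone a) & ~ cl C a.
Proof.
move=> [clM _ ex _] [A [smallA [c [cA ->]] [[v cv rkv] _]]] smallC.
(* Existence moves the point [v] of rank 1 out of the closure of [A] and [C]; having the same type
   over [A] keeps it in the set. *)
have [a [va nACa]] := ex _ _ _ smallA smallC (rk1_notin clM rkv).
exists a; last by move=> Ca; apply: nACa; apply: cl_mono Ca => // x; right.
apply/(va c cA); suff -> : tone (v ord0) = v by [].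
by apply/funext => i; rewrite [i]ord1.
Qed.

Section Construction.
Variables (L : language) (kap : cardinal) (M : structure L).
Variable cl : set M -> set M.
Hypothesis kapL : small kap [set: {n : nat & formula L n}].
Hypothesis clE : existential_matroid kap cl.
Variable b : M.

Definition stage (KF : set M * set M) : Prop :=
  [/\ codable L KF.1, KF.2 `<=` KF.1, KF.1 b & ~ cl KF.2 b].

(** The third clause prepares the Tarski-Vaught test for the union, the fourth density. *)
Definition next_stage (KF KF' : set M * set M) : Prop :=
  [/\ KF.1 `<=` KF'.1, KF.2 `<=` KF'.2,
    forall c : pformula M 1, pf_over KF.1 c -> (exists a, pf_set c (tone a)) ->
      exists2 a, KF'.1 a & pf_set c (tone a)
  & forall c : pformula M 1, pf_over KF.1 c ->
      has_dim kap cl (pf_set c) (Some 1) ->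
      exists2 a, KF'.2 a & pf_set c (tone a)].

Lemma stage_step KF : stage KF -> exists KF', stage KF' /\ next_stage KF KF'.
Proof.
case: KF => K F [/= codK FK Kb nFb].
have codF : codable L F by apply: injects_trans codK; exact: subset_injects.
have clM := em_matroid clE.
have codC := codable_pformula 1 codK.
pose D : set (pformula M 1) :=
  [set c | pf_over K c /\ has_dim kap cl (pf_set c) (Some 1)].
(* Bounding the choices by the set of all sentences keeps them codable, hence small enough for
   Existence. *)
have [||c S [_ dimc] codS|S [codS nFSb SD]] :=
  @generic_choice M cl clM _ _ D [set: sentence L]
    (fun c a => pf_set c (tone a)) F b _ _ nFb.
- by exists Bot.
- by apply: injects_trans codC; apply: subset_injects => c [].
- apply: has_dim1_generic dimc _ => //; apply: codable_small kapL _.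
  by apply: codableU (codable1 _ _); exact: codableU.
have /choice[g gP] : forall c : pformula M 1,
    exists a, (exists x, pf_set c (tone x)) -> pf_set c (tone a).
  move=> c; case: (pselect (exists x, pf_set c (tone x))) => [[x cx]|nc].
    by exists x.
  (* A dummy value for formulas without solutions. *)
  by exists b.
(* The generic points [S] also go into the first component, to keep the second inside it. *)
exists (K `|` S `|` g @` [set c | pf_over K c], F `|` S); split; split => //=.
- by apply: codableU (codable_image _ codC); exact: codableU.
- by move=> x [/FK Kx|Sx]; left; [left|right].
- by left; left.
- by move=> x Kx; left; left.
- by move=> c cK /gP cg; exists (g c) => //; right; exists c.
- by move=> c cK dimc; have [//|a Sa ca] := SD c; exists a => //; right.
Qed.

(** Dependent choice on the type of stages, starting from ({b}, 0). *)
Lemma stage_chain : ~ cl set0 b ->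
  exists KF : nat -> set M * set M,
    forall n, stage (KF n) /\ next_stage (KF n) (KF n.+1).
Proof.
move=> nb.
pose R (s t : {KF | stage KF}) := next_stage (sval s) (sval t).
have step s : {t | R s t}.
  apply: cid; have [KF [KFs sKF]] := stage_step (svalP s).
  by exists (exist _ KF KFs).
have s0 : stage ([set b], set0).
  by split=> //=; exact: codable1.
have [f [_ fP]] := dependent_choice step (exist _ _ s0).
by exists (fun n => sval (f n)) => n; split; [exact: svalP|exact: fP].
Qed.

End Construction.

(** * The dense pair on the union of the stages *)

Theorem lemma8p2 (L : language) (T : theory L) (kap : cardinal) (M : structure L)
    (cl : set M -> set M)
    (T_complete : complete T)
    (T_infinite : only_infinite_models T)
    (M_monster : monster T kap M)
    (cl_existential : existential_matroid kap cl)
    (cl_dim_definable : dim_definable kap cl) :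
  consistent (Td T cl).
Proof.
have clM := em_matroid cl_existential.
have [b nb] : exists b, ~ cl set0 b.
  apply: contrapT => all; apply: (em_nontrivial cl_existential) => A.
  apply/seteqP; split=> // x _; apply: contrapT => nAx; apply: all; exists x.
  by move=> x0; apply: nAx; apply: cl_mono x0.
have [KF KFP] := stage_chain (monster_card M_monster) cl_existential nb.
have mono m n : m <= n -> (KF m).1 `<=` (KF n).1 /\ (KF m).2 `<=` (KF n).2.
  elim: n => [|n IHn]; first by rewrite leqn0 => /eqP->; split.
  rewrite leq_eqVlt => /orP[/eqP->|]; first by split.
  move=> /IHn[K1 F1]; have [_ [K2 F2 _ _]] := KFP n.
  by split; [exact: subset_trans K2|exact: subset_trans F2].
pose K := \bigcup_(n in [set: nat]) (KF n).1.
pose F := \bigcup_(n in [set: nat]) (KF n).2.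
have nat0 : [set: nat] !=set0 by exists 0.
have nFb : ~ cl F b.
  move=> /(cl_chain clM nat0)[|n _].
    by move=> m n _ _; have [/mono[]|/ltnW/mono[]] := leqP m n; [left|right].
  by have [[]] := KFP n.
(* A formula has finitely many parameters, so they all appear at one stage. *)
have over_stage (c : pformula M 1) : pf_over K c -> exists n, pf_over (KF n).1 c.
  move=> cK; have [||n _ cn] := finite_sub_chain nat0 _ _ cK; last by exists n.
    by move=> m n _ _; have [/mono[]|/ltnW/mono[]] := leqP m n; [left|right].
  exact: finite_image.
have K0 : K !=set0 by exists b, 0 => //; have [[]] := KFP 0.
have K_closed (c : pformula M 1) : pf_over K c ->
    (exists a, pf_set c (tone a)) -> exists2 a, K a & pf_set c (tone a).
  move=> /over_stage[n cn] ca; have [_ [_ _ /(_ c cn ca)[a Ka ca'] _]] := KFP n.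
  by exists a => //; exists n.+1.
(* The predicate is the trace of [cl F] on [K], so that idempotence of [cl] makes it closed. *)
pose N := pair_structure (cl F) K0 K_closed.
pose e := @pair_embed L M K (cl F) K0 K_closed.
have elem : elementary_embedding e by exact: pair_embed_elementary.
have trE : transfer cl (N := M) = cl.
  by apply/funext => A; rewrite -(em_definable cl_existential).
exists N => s; apply; split; last split.
- move=> t Tt v; apply/elem; exact: (monster_models M_monster).
- have Kb : K b by exists 0 => //; have [[]] := KFP 0.
  move=> PT; apply: nFb; have : Ppart N (exist _ b Kb) by rewrite PT.
  by [].
(* [M] itself serves as the ambient monster model; there the transferred operator is [cl], by
   [trE]. *)
exists kap, M, e; split=> //.
  rewrite trE; apply/seteqP; split=> [x clx|x Fx].
    change (cl F (e x)); rewrite -(cl_idem clM); apply: (cl_mono clM) clx.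
    by move=> _ [y Fy <-].
  by apply: (cl_ext clM); exists x.
rewrite trE => c dimc.
have [|n cn] := over_stage (pf_map e c).
  by move=> _ [i _ <-]; exact: svalP.
(* Density: a one-dimensional set over stage [n] received a point of the second component at stage
   [n.+1]. *)
have [_ [_ _ _ /(_ _ cn dimc)[a Fa ca]]] := KFP n.
have [[_ FK _ _] _] := KFP n.+1.
have Ka : K a by exists n.+1 => //; exact: FK.
exists (exist _ a Ka); split.
  by apply: (cl_ext clM); exists n.+1.
by apply/elem; rewrite comp_tcat.
Qed.
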